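(* Let $1\le n<\omega$. For every $A\in\mathcal{R}_1$ and every equivalence relation $\mathrm{R}$ on $\mathcal{AR}_n|A$ there is $D\le A$ such that $\mathrm{R}$ is canonical on $\mathcal{AR}_n|D$; that is, there are trees $S_0\in\mathcal{T}(0),\dots,S_{n-1}\in\mathcal{T}(n-1)$ such that for all $a,b\in\mathcal{AR}_n|D$: $a\,\mathrm{R}\,b$ iff $\pi_{S_i}(a(i))=\pi_{S_i}(b(i))$ for all $i<n$.
   Context: Let $\mathbb{T}=\{\langle\rangle\}\cup\{\langle n\rangle:n<\omega\}\cup\{\langle n,i\rangle:n<\omega,\ i\le n\}$. A set $X\subseteq\mathbb{T}$ belongs to $\mathcal{R}_1$ iff there are a strictly increasing sequence $(k_n)_{n<\omega}$ and sets $L_n\subseteq\{0,\dots,k_n\}$ with $|L_n|=n+1$ such that $X=\{\langle\rangle\}\cup\bigcup_{n}(\{\langle k_n\rangle\}\cup\{\langle k_n,i\rangle:i\in L_n\})$; $X(n)=\{\langle\rangle,\langle k_n\rangle\}\cup\{\langle k_n,i\rangle:i\in L_n\}$. Let $r_n(X)=\bigcup_{i<n}X(i)$, $\mathcal{AR}_n=\{r_n(X):X\in\mathcal{R}_1\}$; for $a=r_n(X)\in\mathcal{AR}_n$ and $i<n$, $a(i)=X(i)$. $Y\le X$ iff $Y\subseteq X$. For $A\in\mathcal{R}_1$, $\mathcal{AR}_n|A=\{a\in\mathcal{AR}_n:a\subseteq A\}$. For $n<\omega$, $\mathcal{T}(n)$ consists of the trees $T_{\langle\rangle}=\{\langle\rangle\}$,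 $T_{\langle0\rangle}=\{\langle\rangle,\langle0\rangle\}$, and $T_I=\{\langle\rangle,\langle0\rangle\}\cup\{\langle0,i\rangle:i\in I\}$ for nonempty $I\subseteq\{0,\dots,n\}$. For a tree $u=\{\langle\rangle,\langle k\rangle,\langle k,l_0\rangle,\dots,\langle k,l_n\rangle\}$ with $l_0<\dots<l_n$, the projections are $\pi_{T_{\langle\rangle}}(u)=\{\langle\rangle\}$, $\pi_{T_{\langle0\rangle}}(u)=\{\langle\rangle,\langle k\rangle\}$, and $\pi_{T_I}(u)=\{\langle\rangle,\langle k\rangle\}\cup\{\langle k,l_i\rangle:i\in I\}$. *)

(* Defs.v *)
From mathcomp Require Import all_boot finmap.
From mathcomp Require Import boolp classical_sets.

Set Implicit Arguments.
Unset Strict Implicit.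
Unset Printing Implicit Defensive.

Local Open Scope nat_scope.
Local Open Scope fset_scope.
Local Open Scope classical_set_scope.

Definition bbT : set (seq nat) :=
  [set [::]] `|` [set [:: n] | n in setT]
  `|` [set s | exists n i, i <= n /\ s = [:: n; i]].

Definition fan (k : nat) (L : set nat) : set (seq nat) :=
  [set [::]; [:: k]] `|` [set [:: k; i] | i in L].

Definition presents (X : set (seq nat)) (k : nat -> nat)
    (L : nat -> {fset nat}) : Prop :=
  [/\ {homo k : m n / m < n},
      forall n i, i \in L n -> i <= k n,
      forall n, #|` L n| = n.+1 &
      X = [set [::]] `|`
          \bigcup_n ([set [:: k n]] `|` [set [:: k n; i] | i in [set` L n]])].

Definition R1 : set (set (seq nat)) :=
  [set X | X `<=` bbT /\ exists k L, presents X k L].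

(* X(n); the pair (k, L) presenting X is unique, see [blockE]. *)
Definition block (X : set (seq nat)) (n : nat) : set (seq nat) :=
  [set s | exists k L, presents X k L /\ fan (k n) [set` L n] s].

Definition approx (n : nat) (X : set (seq nat)) : set (seq nat) :=
  \bigcup_(i < n) block X i.

Definition AR (n : nat) : set (set (seq nat)) := [set approx n X | X in R1].

Definition AR_below (n : nat) (A : set (seq nat)) : set (set (seq nat)) :=
  [set a | AR n a /\ a `<=` A].

(* a(i) for a = r_n(X) and i < n; independent of n and X, see [ablockE]. *)
Definition ablock (a : set (seq nat)) (i : nat) : set (seq nat) :=
  [set s | exists n X, [/\ R1 X, i < n, a = approx n X & block X i s]].

Definition calT (n : nat) : set (set (seq nat)) :=
  [set S | [\/ S = [set [::]],
               S = [set [::]; [:: 0]] |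
               exists I : set nat,
                 [/\ I !=set0, I `<=` `I_n.+1 & S = fan 0 I]]].

Definition relabel (k : nat) (l s : seq nat) : seq nat :=
  match s with
  | [::] => [::]
  | [:: _] => [:: k]
  | _ :: i :: _ => [:: k; nth 0 l i]
  end.

(* pi_S(u) for u = {<>, <k>, <k, l_0>, ..., <k, l_n>} with l_0 < ... < l_n:
   the image of S under <> |-> <>, <0> |-> <k>, <0, i> |-> <k, l_i>.  The pair
   (k, l) is determined by u; [proj_root], [proj_stem] and [proj_fan] give the
   values on the three kinds of trees in calT n. *)
Definition proj (S u : set (seq nat)) : set (seq nat) :=
  [set s | exists k l, [/\ sorted ltn l, u = fan k [set` l] &
                           (relabel k l @` S) s]].

Definition equiv_on (T : Type) (P : set T) (R : T -> T -> Prop) : Prop :=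
  [/\ forall a, P a -> R a a,
      forall a b, P a -> P b -> R a b -> R b a &
      forall a b c, P a -> P b -> P c -> R a b -> R b c -> R a c].

Definition canonical_on (n : nat) (D : set (seq nat))
    (R : set (seq nat) -> set (seq nat) -> Prop) : Prop :=
  exists S : nat -> set (seq nat),
    (forall i, i < n -> calT i (S i)) /\
    forall a b, AR_below n D a -> AR_below n D b ->
      (R a b <->
       forall i, i < n -> proj (S i) (ablock a i) = proj (S i) (ablock b i)).

Lemma fan_stem k L k' : fan k L [:: k'] <-> k' = k.
Proof.
by split=> [[[//|[->]]|[]//]|->]//; left; right.
Qed.

Lemma fan_leaf k L k' i : fan k L [:: k'; i] <-> k' = k /\ L i.
Proof.
split=> [[[//|//]|[j Lj [<- <-]]]|[-> Li]] //; by right; exists i.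
Qed.

Lemma fan_inj k k' L L' : fan k L = fan k' L' -> k = k' /\ L = L'.
Proof.
move=> e; have ek : k = k' by apply/(fan_stem k' L'); rewrite -e fan_stem.
split=> //; apply/seteqP; split=> i Li.
  by have /fan_leaf[] : fan k' L' [:: k; i] by rewrite -e; apply/fan_leaf.
by have /fan_leaf[] : fan k L [:: k'; i] by rewrite e; apply/fan_leaf.
Qed.

Lemma fans_uniq (P Q : set nat) (k k' : nat -> nat) (L L' : nat -> {fset nat}) :
  (forall i j, j < i -> P i -> P j) -> (forall i j, j < i -> Q i -> Q j) ->
  {homo k : m n / m < n} -> {homo k' : m n / m < n} ->
  \bigcup_(i in P) fan (k i) [set` L i] =
    \bigcup_(i in Q) fan (k' i) [set` L' i] ->
  forall i, P i -> Q i -> k i = k' i /\ L i = L' i.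
Proof.
move=> clP clQ incr incr' e.
have inj : injective k.
  by move=> x y exy; case: (ltngtP x y) => // /incr; rewrite exy ltnn.
have inj' : injective k'.
  by move=> x y exy; case: (ltngtP x y) => // /incr'; rewrite exy ltnn.
have fwd j : P j -> exists2 j', Q j' & k j = k' j'.
  move=> Pj; have : (\bigcup_(i in P) fan (k i) [set` L i]) [:: k j].
    by exists j => //; apply/fan_stem.
  by rewrite e => -[j' Qj' /fan_stem ?]; exists j'.
have bwd j : Q j -> exists2 j', P j' & k' j = k j'.
  move=> Qj; have : (\bigcup_(i in Q) fan (k' i) [set` L' i]) [:: k' j].
    by exists j => //; apply/fan_stem.
  by rewrite -e => -[j' Pj' /fan_stem ?]; exists j'.
have ek i : P i -> Q i -> k i = k' i.
  elim/ltn_ind: i => i IH Pi Qi; apply/eqP; rewrite eqn_leq; apply/andP; split.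
    have [j Pj ej] := bwd i Qi; rewrite ej; case: (ltngtP j i) => [ji|ij|-> //].
      have ij := inj' _ _ (etrans ej (IH j ji Pj (clQ i j ji Qi))).
      by rewrite ij ltnn in ji.
    exact/ltnW/incr.
  have [j Qj ej] := fwd i Pi; rewrite ej; case: (ltngtP j i) => [ji|ij|-> //].
    have ij := inj _ _ (etrans ej (esym (IH j ji (clP i j ji Pi) Qj))).
    by rewrite ij ltnn in ji.
  exact/ltnW/incr'.
move=> i Pi Qi; split; first exact: ek.
apply/fsetP => l; apply/idP/idP => Ll.
  have : (\bigcup_(i in P) fan (k i) [set` L i]) [:: k i; l].
    by exists i => //; apply/fan_leaf.
  by rewrite e ek// => -[j _ /fan_leaf[/inj' <-]].
have : (\bigcup_(i in Q) fan (k' i) [set` L' i]) [:: k' i; l].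
  by exists i => //; apply/fan_leaf.
by rewrite -e -ek// => -[j _ /fan_leaf[/inj <-]].
Qed.

Lemma presents_bigcup X k L : presents X k L ->
  X = \bigcup_(i in setT) fan (k i) [set` L i].
Proof.
case=> _ _ _ ->; apply/seteqP; split=> s.
  move=> [->|[i _ [->|[l Ll <-]]]].
  - by exists 0 => //; left; left.
  - by exists i => //; left; right.
  - by exists i => //; right; exists l.
move=> [i _ [[->|->]|[l Ll <-]]]; first by left.
- by right; exists i => //; left.
- by right; exists i => //; right; exists l.
Qed.

Lemma presents_uniq X k L k' L' : presents X k L -> presents X k' L' ->
  forall i, k i = k' i /\ L i = L' i.
Proof.
move=> p p' i; have [incr _ _ _] := p; have [incr' _ _ _] := p'.
apply: (fans_uniq (P := setT) (Q := setT)) => //.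
by rewrite -(presents_bigcup p) -(presents_bigcup p').
Qed.

Lemma blockE X k L n : presents X k L -> block X n = fan (k n) [set` L n].
Proof.
move=> p; apply/seteqP; split=> s; last by move=> h; exists k, L.
by move=> [k' [L' [p']]]; have [-> ->] := presents_uniq p p' n.
Qed.

Lemma ablockE n X i : R1 X -> i < n -> ablock (approx n X) i = block X i.
Proof.
move=> RX ni; apply/seteqP; split=> s; last by move=> h; exists n, X.
move=> [m [Y [RY mi e]]].
have [_ [k [L p]]] := RX; have [_ [k' [L' p']]] := RY.
have [incr _ _ _] := p; have [incr' _ _ _] := p'.
have eX : approx n X = \bigcup_(i in `I_n) fan (k i) [set` L i].
  by apply: eq_bigcupr => j _; exact: blockE.
have eY : approx m Y = \bigcup_(i in `I_m) fan (k' i) [set` L' i].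
  by apply: eq_bigcupr => j _; exact: blockE.
rewrite (blockE i p) (blockE i p').
have cl q x y : y < x -> `I_q x -> `I_q y by move=> /ltn_trans; apply.
by have [-> ->] := fans_uniq (cl n) (cl m) incr incr'
  (etrans (esym eX) (etrans e eY)) ni mi.
Qed.

Lemma projE S k l : sorted ltn l ->
  proj S (fan k [set` l]) = relabel k l @` S.
Proof.
move=> sl; apply/seteqP; split=> s; last by exists k, l.
move=> [k' [l' [sl' /fan_inj[<- e]]]].
suff -> : l = l' by [].
apply: (irr_sorted_eq ltn_trans ltnn sl sl') => x.
by apply/idP/idP => xl; [have : [set` l'] x by rewrite -e
                        |have : [set` l] x by rewrite e].
Qed.

Lemma proj_root k l : sorted ltn l ->
  proj [set [::]] (fan k [set` l]) = [set [::]].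
Proof. by move=> sl; rewrite projE// image_set1. Qed.

Lemma proj_stem k l : sorted ltn l ->
  proj [set [::]; [:: 0]] (fan k [set` l]) = [set [::]; [:: k]].
Proof. by move=> sl; rewrite projE// image_setU !image_set1. Qed.

Lemma proj_fan (I : set nat) k l : sorted ltn l ->
  proj (fan 0 I) (fan k [set` l]) = fan k [set nth 0 l i | i in I].
Proof.
move=> sl; rewrite projE// /fan !image_setU !image_set1; congr (_ `|` _).
by rewrite image_comp [RHS]image_comp.
Qed.

(* Main.v *)
(** Erdős-Rado style canonization.  A Ramsey theorem for finite configurations
    (finitely many stems, with prescribed numbers of leaves) makes the truth of
    [a R b] depend only on the joint order type of the pair (a, b), for all a, b
    below a member E of R_1.  Call a coordinate of AR_n (the stem of the i-th
    block, or the j-th leaf of the i-th block) irrelevant if some, equivalently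
    every, pair differing only in that coordinate is R-related.  Let D consist
    of every third stem and every third leaf of E.  If a and b below D agree on
    the relevant coordinates, single irrelevant moves lead from both to a common
    coordinatewise minimum.  Conversely let [a R b], and suppose that a relevant
    stem of a is not a relevant stem of b.  Pushing the irrelevant stems of b
    two places up inside E, and then this stem of a one place up, keeps the type
    of the pair, so the stem was irrelevant.  Hence the sets of relevant stems
    of a and b coincide, hence so do their increasing enumerations; leaves are
    treated in the same way. *)

Require Import Defs.
From mathcomp Require Import all_boot finmap.
From mathcomp Require Import boolp classical_sets.
From mathcomp Require Import zify.

Set Implicit Arguments.
Unset Strict Implicit.
Unset Printing Implicit Defensive.

Local Open Scope classical_set_scope.

(** * Ramsey theorem for configurations *)

(** A long list is first thinned until the colour of a sublist of length [w.+1] depends only on its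
    first entry. Keeping [m + m] entries then leaves [m] of them with one colour. *)
Lemma finite_ramsey (T : eqType) (w m : nat) :
  exists M, forall (s : seq T) (P : seq T -> bool), uniq s -> M <= size s ->
    exists t b, [/\ subseq t s, m <= size t &
      forall u, subseq u t -> size u = w -> P u = b].
Proof.
elim: w m => [|w IH] m.
  by exists m => s P _ ms; exists s, (P [::]); split=> // u _ /size0nil ->.
have end_homogeneous : exists M, forall (s : seq T) (P : seq T -> bool),
    uniq s -> M <= size s -> exists t (h : T -> bool),
    [/\ subseq t s, m + m <= size t &
      forall x u, subseq (x :: u) t -> size u = w -> P (x :: u) = h x].
  elim: (m + m) => [|p [M HM]].
    by exists 0 => s P _ _; exists [::], xpredT; split=> //; exact: sub0seq.
  have [M' HM'] := IH M; exists M'.+1 => -[//|x s] P /= /andP[xs us] sz.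
  have [t [b [ts Mt Hb]]] := HM' s (fun u => P (x :: u)) us sz.
  have [t' [h [tt' pt' Hh]]] := HM t P (subseq_uniq ts us) Mt.
  exists (x :: t'), (fun y => if y == x then b else h y); split=> //=.
    by rewrite eqxx (subseq_trans tt').
  move=> y u; case: eqP => [->|_] su sw; last exact: Hh.
  by apply: Hb => //; exact: subseq_trans tt'.
have [M HM] := end_homogeneous; exists M => s P us Ms.
have [t [h [ts mt Hh]]] := HM s P us Ms.
suff [b mb] : exists b, m <= size [seq x <- t | h x == b].
  exists [seq x <- t | h x == b], b; split=> //.
    exact: subseq_trans (filter_subseq _ _) ts.
  move=> [//|x u] xu [su].
  rewrite (Hh x u)//; last exact: subseq_trans xu (filter_subseq _ _).
  by have := mem_subseq xu (mem_head x u); rewrite mem_filter => /andP[/eqP].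
have : count (fun x => h x == true) t + count (fun x => h x == false) t = size t.
  by rewrite -(count_predC (fun x => h x == true)); congr addn;
    apply: eq_count => x /=; case: (h x).
case: (leqP m (count (fun x => h x == true) t)) => [mb _|lt e].
  by exists true; rewrite size_filter.
by exists false; rewrite size_filter; lia.
Qed.

Fixpoint words (T : Type) (s : seq T) (m : nat) : seq (seq T) :=
  if m is m'.+1 then [seq x :: v | x <- s, v <- words s m'] else [:: [::]].

Lemma mem_words (T : eqType) (s v : seq T) :
  {subset v <= s} -> v \in words s (size v).
Proof.
elim: v => [//|x v IH] sub /=; apply/allpairsP; exists (x, v); split=> //=.
  exact/sub/mem_head.
by apply: IH => y yv; apply: sub; rewrite inE yv orbT.
Qed.

Definition words_le (T : Type) (s : seq T) (m : nat) : seq (seq T) :=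
  flatten [seq words s j | j <- iota 0 m.+1].

Lemma mem_words_le (T : eqType) (s v : seq T) m :
  {subset v <= s} -> size v <= m -> v \in words_le s m.
Proof.
move=> sub vm; apply/flattenP; exists (words s (size v)); last exact: mem_words.
by apply: map_f; rewrite mem_iota.
Qed.

(** * Fat families of leaf lists and their finite configurations *)

Definition refines (F G : nat -> seq nat) := forall k, subseq (F k) (G k).

(** [F k] lists the leaves over the stem [k]; an empty list stands for an absent stem. *)
Definition fat (F : nat -> seq nat) :=
  (forall k, sorted ltn (F k)) /\
  forall m, exists2 k, m <= k & m <= size (F k).

Definition config (F : nat -> seq nat) (c : seq (nat * seq nat)) :=
  sorted ltn (unzip1 c) /\
  forall t, t \in c -> t.2 != [::] /\ subseq t.2 (F t.1).

Definition homog (F : nat -> seq nat) (sh : seq nat)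
    (P : seq (nat * seq nat) -> bool) :=
  exists b, forall c, config F c -> shape (unzip2 c) = sh -> P c = b.

Lemma refines_refl F : refines F F.
Proof. by move=> k; exact: subseq_refl. Qed.

Lemma refines_trans F G H : refines F G -> refines G H -> refines F H.
Proof. by move=> FG GH k; exact: subseq_trans (FG k) (GH k). Qed.

Lemma config_refines F G c : refines F G -> config F c -> config G c.
Proof.
move=> FG [sc Hc]; split=> // t /Hc[? ts]; split=> //.
exact: subseq_trans ts (FG _).
Qed.

Lemma homog_refines F G sh P : refines F G -> homog G sh P -> homog F sh P.
Proof. by move=> FG [b H]; exists b => c /(config_refines FG); exact: H. Qed.

(** Homogeneity passes to refinements, so finitely many properties can be treated one after
    another. *)
Lemma homog_all (J : eqType) (js : seq J) (sh : J -> seq nat)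
    (P : J -> seq (nat * seq nat) -> bool) F :
  (forall j P F, fat F ->
     exists F', [/\ fat F', refines F' F & homog F' (sh j) P]) ->
  fat F ->
  exists F', [/\ fat F', refines F' F & {in js, forall j, homog F' (sh j) (P j)}].
Proof.
move=> H fF; elim: js => [|j js [F1 [fF1 r1 h1]]].
  by exists F; split.
have [F2 [fF2 r2 h2]] := H j (P j) F1 fF1; exists F2; split=> //.
  exact: refines_trans r1.
move=> i; rewrite inE => /orP[/eqP -> //|/h1]; exact: homog_refines.
Qed.

Definition spread (K : nat -> nat) (s : nat -> seq nat) (k : nat) : seq nat :=
  if pselect (exists j, K j = k) is left e then s (projT1 (cid e)) else [::].

Lemma spreadE K s j : injective K -> spread K s (K j) = s j.
Proof.
move=> injK; rewrite /spread; case: pselect => [e|[]]; last by exists j.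
by case: cid => i /= /injK ->.
Qed.

Lemma spreadN K s k : spread K s k = [::] \/ exists j, k = K j.
Proof.
by rewrite /spread; case: pselect => [e|]; [case: (e) => j; right; exists j|left].
Qed.

(** * Fusion of a decreasing sequence of fat families *)

Section Fusion.
Variables (Q : nat -> seq nat -> (nat -> seq nat) -> Prop) (F : nat -> seq nat).
Hypothesis fF : fat F.
Hypothesis Q_dense : forall F0, fat F0 -> refines F0 F -> forall m,
  exists k s G, [/\ m <= k, m <= size s, subseq s (F0 k) &
                    [/\ fat G, refines G F0 & Q k s G]].

Let state := {G : nat -> seq nat | fat G /\ refines G F}.

Lemma fusion_step (p : nat * state) : exists q : nat * seq nat * state,
  [/\ p.1 <= q.1.1, p.1 <= size q.1.2, subseq q.1.2 (sval p.2 q.1.1) &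
      refines (sval q.2) (sval p.2) /\ Q q.1.1 q.1.2 (sval q.2)].
Proof.
case: p => m [F0 [fF0 r0]].
have [k [s [G [mk ms sF [fG rG QG]]]]] := Q_dense fF0 r0 m.
by exists (k, s, exist _ G (conj fG (refines_trans rG r0))).
Qed.

(** [Q k s G] is a promise about the block [s] over [k] relative to a reservoir [G] for later
    blocks. Each block is picked from the current reservoir and reservoirs only shrink, so all later
    blocks of [F'] lie inside the promised [G]. *)
Lemma fusion : exists F', [/\ fat F', refines F' F &
  forall k, F' k != [::] ->
    exists G, Q k (F' k) G /\ forall j, k < j -> subseq (F' j) (G j)].
Proof.
have [f Hf] := choice fusion_step.
(* The first component bounds the next stem and the size of its block from below; taking the
   successor of the last stem makes [K] strictly increasing. *)
pose g := fix g j : nat * state :=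
  if j is j'.+1 then ((f (g j')).1.1.+1, (f (g j')).2)
  else (0, exist _ F (conj fF (refines_refl F))).
pose K j := (f (g j)).1.1; pose s j := (f (g j)).1.2; pose G j := sval (g j).2.
have leK j : (g j).1 <= K j by case: (Hf (g j)).
have jg j : j <= (g j).1.
  by elim: j => // j /leq_trans/(_ (leK j)).
have mK : {homo K : i j / i < j}.
  by apply: homo_ltn => [|j]; [exact: ltn_trans | exact: leK j.+1].
have injK : injective K.
  by move=> x y exy; case: (ltngtP x y) => // /mK; rewrite exy ltnn.
have rG j i : i <= j -> refines (G j) (G i).
  move=> /subnKC <-; elim: (j - i) => [|d IH].
    by rewrite addn0; exact: refines_refl.
  apply: refines_trans IH; rewrite addnS.
  by have [_ _ _ []] := Hf (g (i + d)).
have sG j : subseq (s j) (G j (K j)) by case: (Hf (g j)).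
pose F' := spread K s.
have F'K j : F' (K j) = s j by exact: spreadE.
have F'N k : F' k = [::] \/ exists j, k = K j by exact: spreadN.
have rF' : refines F' F.
  move=> k; case: (F'N k) => [->|[j ->]]; first exact: sub0seq.
  by rewrite F'K (subseq_trans (sG j))//; exact: (rG j 0).
exists F'; split=> //.
- split=> [k|m]; first exact: subseq_sorted ltn_trans _ _ (rF' k) (fF.1 k).
  exists (K m); first exact: leq_trans (jg m) (leK m).
  by rewrite F'K; have [_ h _ _] := Hf (g m); exact: leq_trans (jg m) h.
- move=> k; case: (F'N k) => [->//|[j -> _]].
  exists (G j.+1); split; first by rewrite F'K; have [_ _ _ []] := Hf (g j).
  move=> k'; case: (F'N k') => [-> _|[j' ->] jj']; first exact: sub0seq.
  rewrite F'K (subseq_trans (sG j'))//; apply: rG.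
  rewrite ltnNge; apply/negP; rewrite leq_eqVlt => /orP[/eqP e|/mK]; last by lia.
  by move: jj'; rewrite e ltnn.
Qed.

End Fusion.

(** Induction on the shape, splitting off the first block. Over a suitable stem the colour is made
    independent first of the later blocks, then of the choice of leaves. One of the two resulting
    stem colours is available densely, and fusion builds a family from stems of that colour
    alone. *)
Lemma config_ramsey sh P F : fat F ->
  exists F', [/\ fat F', refines F' F & homog F' sh P].
Proof.
elim: sh P F => [|w sh IH] P F fF.
  exists F; split=> //.
  by exists (P [::]) => -[].
pose Q b k s G := forall l c, subseq l s -> config G c ->
  shape (unzip2 ((k, l) :: c)) = w :: sh -> P ((k, l) :: c) = b.
have some_color F0 m : fat F0 -> exists k s G,
    [/\ m <= k, m <= size s, subseq s (F0 k) &
        [/\ fat G, refines G F0 & exists b, Q b k s G]].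
  move=> fF0; have [M HM] := finite_ramsey nat w m.
  have [k km kM] := fF0.2 (maxn m M).
  (* Only finitely many leaf lists [l] fit over [k], so one refinement makes the colour of
     [(k, l) :: c] independent of [c] for all of them. *)
  have [//|//|t [ft tF0 hm]] := @homog_all _ (words_le (F0 k) (size (F0 k)))
    (fun=> sh) (fun l c => P ((k, l) :: c)) F0.
  have [] := @choice _ _ (fun l b => l \in words_le (F0 k) (size (F0 k)) ->
      forall c, config t c -> shape (unzip2 c) = sh -> P ((k, l) :: c) = b).
    move=> l; case: (boolP (l \in words_le _ _)) => [/hm[b Hb]|_].
      by exists b.
    by exists true.
  move=> col Hcol.
  have uF0 := sorted_uniq ltn_trans ltnn (fF0.1 k).
  have [|s [b [sF0 ms Hs]]] := HM (F0 k) col uF0.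
    exact: leq_trans (leq_maxr _ _) kM.
  exists k, s, t; split=> //; first lia; split=> //.
  exists b => l c ls tc [lw csh]; rewrite (Hcol l)//; first exact: Hs.
  have lF := subseq_trans ls sF0.
  by apply: mem_words_le (size_subseq lF); exact: mem_subseq.
(* If [true] is not dense below [F], it fails beyond some [m0] in some [F1]; then every stem found
   beyond [m0] below [F1] has colour [false]. *)
have [b [F1 [fF1 r1 dense]]] : exists b F1, [/\ fat F1, refines F1 F &
    forall F0, fat F0 -> refines F0 F1 -> forall m, exists k s G,
      [/\ m <= k, m <= size s, subseq s (F0 k) &
          [/\ fat G, refines G F0 & Q b k s G]]].
  case: (pselect (forall F0, fat F0 -> refines F0 F -> forall m, exists k s G,
      [/\ m <= k, m <= size s, subseq s (F0 k) &
          [/\ fat G, refines G F0 & Q true k s G]])) => [?|].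
    by exists true, F; split.
  move=> /existsNP[F1 /not_implyP[fF1 /not_implyP[r1 /existsNP[m0 no]]]].
  exists false, F1; split=> // F0 fF0 r0 m.
  have [k [s [G [mk ms sF0 [fG rG [[] QG]]]]]] := some_color F0 (maxn m m0) fF0.
    case: no; exists k, s, G; split; try lia.
      exact: subseq_trans sF0 (r0 k).
    by split=> //; exact: refines_trans r0.
  by exists k, s, G; split=> //; lia.
have [F' [fF' r' HF']] := fusion fF1 dense.
exists F'; split=> //; first exact: refines_trans r1.
exists b => -[//|[k l] c] [/= kc Hc] shc.
have [/= l0 lF'] := Hc (k, l) (mem_head _ _).
have [|G [QG HG]] := HF' k.
  by apply: contraNneq l0 => e; move: lF'; rewrite e subseq0.
apply: QG => //; split; first exact: path_sorted kc.
move=> t tc; have [|t0 tF'] := Hc t; first by rewrite inE tc orbT.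
split=> //; apply: subseq_trans tF' (HG _ _).
by move: kc; rewrite (path_sortedE ltn_trans) => /andP[/allP/(_ _ (map_f fst tc))].
Qed.

(** * Relevant coordinates *)

(** By induction the values agree at smaller indices in [P], so the partner of [f i] under [g] has
    index at least [i], whence [g i <= f i]; the converse is symmetric. *)
Lemma increasing_same_image N (P : nat -> Prop) (f g : nat -> nat) :
  (forall i j, i < j -> j < N -> f i < f j) ->
  (forall i j, i < j -> j < N -> g i < g j) ->
  (forall i, i < N -> P i -> exists k, [/\ k < N, P k & f i = g k]) ->
  (forall i, i < N -> P i -> exists k, [/\ k < N, P k & g i = f k]) ->
  forall i, i < N -> P i -> f i = g i.
Proof.
move=> mf mg fg gf; elim/ltn_ind => i IH iN Pi.
have [k [kN Pk fi]] := fg i iN Pi; have [p [pN Pp gi]] := gf i iN Pi.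
have ik : i <= k.
  by rewrite leqNgt; apply/negP => ki; have := mf k i ki iN; rewrite (IH k)//; lia.
have ip : i <= p.
  by rewrite leqNgt; apply/negP => pi; have := mg p i pi iN; rewrite -(IH p)//; lia.
have : g i <= g k by move: ik; rewrite leq_eqVlt => /orP[/eqP->//|/mg/(_ kN)/ltnW].
have : f i <= f p by move: ip; rewrite leq_eqVlt => /orP[/eqP->//|/mf/(_ pN)/ltnW].
lia.
Qed.

(** Positions inside a fixed fat family: [a.1 i] is the index of the [i]-th stem among the chosen
    stems, and [a.2 i j] the rank of its [j]-th leaf in the list over that stem. *)
Definition coords := ((nat -> nat) * (nat -> nat -> nat))%type.

(** The bound [a.1 i + 3] matches families with at least [k + 3] leaves over the stem of index [k];
    the surplus leaves room for shifting leaves. *)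
Definition valid n (a : coords) :=
  [/\ forall i k, i < k -> k < n -> a.1 i < a.1 k,
      forall i j p, i < n -> j < p -> p <= i -> a.2 i j < a.2 i p &
      forall i j, i < n -> j <= i -> a.2 i j < a.1 i + 3].

Definition same_order (x y x' y' : nat) :=
  (x < y <-> x' < y') /\ (y < x <-> y' < x').

(** Leaves are compared only over a common stem, since otherwise they belong to different blocks of
    the joint configuration. *)
Definition same_type n (a b a' b' : coords) :=
  forall i k, i < n -> k < n ->
    same_order (a.1 i) (b.1 k) (a'.1 i) (b'.1 k) /\
    (a.1 i = b.1 k -> forall j p, j <= i -> p <= k ->
       same_order (a.2 i j) (b.2 k p) (a'.2 i j) (b'.2 k p)).

Definition agree_block i (a b : coords) :=
  a.1 i = b.1 i /\ forall j, j <= i -> a.2 i j = b.2 i j.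

Definition agree_off n i (a b : coords) :=
  forall k, k < n -> k <> i -> agree_block k a b.

Definition agree_off_leaf n i j (a b : coords) :=
  (forall k, k < n -> a.1 k = b.1 k) /\
  forall k p, k < n -> p <= k -> ~ (k = i /\ p = j) -> a.2 k p = b.2 k p.

(** Multiples of three leave the residues 1 and 2 free for shifts that preserve strict
    inequalities. *)
Definition spaced n (a : coords) :=
  forall i, i < n -> a.1 i %% 3 = 0 /\ forall j, j <= i -> a.2 i j %% 3 = 0.

Lemma valid_stem n a i k : valid n a -> i < n -> k < n ->
  (a.1 i < a.1 k) = (i < k).
Proof.
case=> h _ _ li lk; have h1 := h i k; have h2 := h k i.
by case: (ltngtP i k) => [|| ->]; lia.
Qed.

Lemma valid_leaf n a i j p : valid n a -> i < n -> j <= i -> p <= i ->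
  (a.2 i j < a.2 i p) = (j < p).
Proof.
case=> _ h _ li lj lp; have h1 := h i j p li; have h2 := h i p j li.
by case: (ltngtP j p) => [|| ->]; lia.
Qed.

Lemma valid_stem_ge n a i : valid n a -> i < n -> i <= a.1 i.
Proof.
move=> [h _ _]; elim: i => // i IH li.
by have := h i i.+1 (ltnSn i) li; have := IH (ltnW li); lia.
Qed.

Lemma agree_block_sym i a b : agree_block i a b -> agree_block i b a.
Proof. by move=> [e h]; split=> // j /h. Qed.

(** * Canonization of an equivalence relation that depends only on order types *)

Section Canonization.
Variables (n : nat) (Q : coords -> coords -> Prop).
Hypothesis Q_refl : forall a, valid n a -> Q a a.
Hypothesis Q_sym : forall a b, valid n a -> valid n b -> Q a b -> Q b a.
Hypothesis Q_trans : forall a b c, valid n a -> valid n b -> valid n c ->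
  Q a b -> Q b c -> Q a c.
Hypothesis Q_type : forall a b a' b', valid n a -> valid n b -> valid n a' ->
  valid n b' -> same_type n a b a' b' -> Q a b -> Q a' b'.

(** The leaves of block [i] may differ too: once its stems differ, the type of the pair does not see
    them. *)
Definition irrelevant_stem i := exists a b,
  [/\ valid n a, valid n b, agree_off n i a b, a.1 i <> b.1 i & Q a b].

Definition irrelevant_leaf i j := exists a b,
  [/\ valid n a, valid n b, agree_off_leaf n i j a b, a.2 i j <> b.2 i j & Q a b].

Lemma Q_ext a b : valid n a -> valid n b ->
  (forall k, k < n -> agree_block k a b) -> Q a b.
Proof.
move=> va vb ab; apply: (Q_type va va va vb _ (Q_refl va)) => i k li lk.
have [<- h] := ab k lk; split; first by [].
by move=> _ j p _ lp; rewrite -h.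
Qed.

(** Both [i]-th stems lie between the same neighbours, so the order pattern is forced and the same
    for all such pairs. *)
Lemma order_off_stem i a b : i < n -> valid n a -> valid n b ->
  agree_off n i a b -> a.1 i < b.1 i ->
  forall k p, k < n -> p < n ->
    ((a.1 k < b.1 p) = (k < p) || (k == i) && (p == i)) *
    ((b.1 p < a.1 k) = (p < k)).
Proof.
move=> li va vb ab lti k p lk lp.
case: (eqVneq p i) => [->|/eqP npi].
  case: (eqVneq k i) => [->|/eqP nki].
    by rewrite ltnn; split; lia.
  by have [-> _] := ab k lk nki; rewrite !(valid_stem vb)//= orbF.
by have [<- _] := ab p lp npi; rewrite !(valid_stem va)// andbF orbF.
Qed.

(** Once both pairs are oriented by symmetry of [Q], the given pair has the type of the witnessing
    pair. *)
Lemma Q_irrelevant_stem i a b : i < n -> irrelevant_stem i ->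
  valid n a -> valid n b -> agree_off n i a b -> a.1 i <> b.1 i -> Q a b.
Proof.
move=> li [a0 [b0 []]].
wlog lt0 : a0 b0 / a0.1 i < b0.1 i => [hw va0 vb0 ab0 ne0 Q0|].
  case: (ltngtP (a0.1 i) (b0.1 i)) => // lt0; first exact: (hw a0 b0).
  apply: (hw b0 a0) => //; [|exact: nesym|exact: Q_sym].
  by move=> k lk nk; exact/agree_block_sym/ab0.
move=> va0 vb0 ab0 _ Q0.
wlog lt : a b / a.1 i < b.1 i => [hw va vb ab ne|].
  case: (ltngtP (a.1 i) (b.1 i)) => // lt; first exact: (hw a b).
  apply: Q_sym => //; apply: (hw b a) => //; last exact: nesym.
  by move=> k lk nk; exact/agree_block_sym/ab.
move=> va vb ab _; apply: (Q_type va0 vb0 va vb _ Q0) => k p lk lp.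
have o0 := order_off_stem li va0 vb0 ab0 lt0 lk lp.
have o := order_off_stem li va vb ab lt lk lp.
split; first by rewrite /same_order !o0 !o.
(* A stem common to both members comes from an unmoved block with the same index, where the leaves
   agree. *)
move=> e; have [ekp ki] : k = p /\ k <> i by move: o0; rewrite e ltnn => -[]; lia.
subst p => j p lj lp'.
have [_ <-//] := ab0 k lk ki; have [_ <-//] := ab k lk ki.
by rewrite /same_order !(valid_leaf va0) // !(valid_leaf va).
Qed.

Lemma order_off_leaf i j a b : i < n -> j <= i -> valid n a -> valid n b ->
  agree_off_leaf n i j a b -> a.2 i j < b.2 i j ->
  forall k q p, k < n -> q <= k -> p <= k ->
    ((a.2 k q < b.2 k p) = (q < p) || [&& k == i, q == j & p == j]) *
    ((b.2 k p < a.2 k q) = (p < q)).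
Proof.
move=> li lj va vb [_ ab] lt k q p lk lq lp.
case: (pselect (k = i /\ p = j)) => [[ek ep]|np].
  subst k p; rewrite !eqxx /= andbT.
  case: (eqVneq q j) => [->|/eqP nqj]; first by rewrite ltnn; split; lia.
  by rewrite ab ?(valid_leaf vb) ?orbF//; lia.
rewrite -ab// !(valid_leaf va)//; split=> //; lia.
Qed.

Lemma Q_irrelevant_leaf i j a b : i < n -> j <= i -> irrelevant_leaf i j ->
  valid n a -> valid n b -> agree_off_leaf n i j a b -> Q a b.
Proof.
have sym a' b' : agree_off_leaf n i j a' b' -> agree_off_leaf n i j b' a'.
  by move=> [h1 h2]; split=> [k /h1|k p lk lp np]//; rewrite h2.
move=> li lj [a0 [b0 []]].
wlog lt0 : a0 b0 / a0.2 i j < b0.2 i j => [hw va0 vb0 ab0 ne0 Q0|].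
  case: (ltngtP (a0.2 i j) (b0.2 i j)) => // lt0; first exact: (hw a0 b0).
  by apply: (hw b0 a0) => //; [exact: sym|exact: nesym|exact: Q_sym].
move=> va0 vb0 ab0 _ Q0.
wlog lt : a b / a.2 i j < b.2 i j => [hw va vb ab|].
  case: (ltngtP (a.2 i j) (b.2 i j)) => [lt|lt|e]; first exact: (hw a b).
    by apply: Q_sym => //; apply: (hw b a) => //; exact: sym.
  apply: Q_ext => // k lk; split=> [|p lp]; first exact: ab.1.
  case: (pselect (k = i /\ p = j)) => [[-> ->]//|np]; exact: ab.2.
move=> va vb ab; apply: (Q_type va0 vb0 va vb _ Q0) => k p lk lp.
rewrite -(ab0.1 p lp) -(ab.1 p lp) /same_order.
rewrite !(valid_stem va0)// !(valid_stem va)//.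
split=> // e.
have ekp : k = p by have := valid_stem va0 lk lp; have := valid_stem va0 lp lk; lia.
subst p => q p lq lp'.
rewrite !(order_off_leaf li lj va0 vb0 ab0 lt0)//.
by rewrite !(order_off_leaf li lj va vb ab lt).
Qed.

(** The hybrid [c t] takes its blocks below [t] from [b] and the others from [a]. Its stems increase
    because [b.1 i <= a.1 i < a.1 k] for [i < t <= k]. *)
Lemma Q_blockwise a b : valid n a -> valid n b ->
  (forall k, k < n -> b.1 k <= a.1 k) ->
  (forall t a' b', t < n -> valid n a' -> valid n b' -> agree_off n t a' b' ->
     agree_block t a' a -> agree_block t b' b -> Q a' b') ->
  Q a b.
Proof.
move=> va vb ba H.
pose c t : coords := (fun k => if k < t then b.1 k else a.1 k,
                      fun k => if k < t then b.2 k else a.2 k).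
have vc t : valid n (c t).
  split=> /= [i k ik lk|i j p li jp lp|i j li lj].
  - have := valid_stem va (ltn_trans ik lk) lk.
    have := valid_stem vb (ltn_trans ik lk) lk.
    have := ba i (ltn_trans ik lk).
    by case: (ltnP i t); case: (ltnP k t); lia.
  - have lj : j <= i by lia.
    by case: (ltnP i t) => _; [rewrite (valid_leaf vb)|rewrite (valid_leaf va)].
  - by case: (ltnP i t) => _; [case: vb|case: va] => _ _; apply.
have Qc t : t <= n -> Q a (c t).
  elim: t => [_|t IH lt]; first by apply: Q_ext.
  apply: (Q_trans va (vc t)) => //; first exact/IH/ltnW.
  apply: (H t) => //;
    try by [rewrite /agree_block /= ltnn|rewrite /agree_block /= leqnn].
  move=> k lk nk; rewrite /agree_block /=.
  by have -> : (k < t.+1) = (k < t) by lia.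
apply: (Q_trans va (vc n)) => //; first exact: Qc.
by apply: Q_ext => // k lk; rewrite /agree_block /= lk.
Qed.

(** The same interpolation inside one block: leaves are lowered from the left, one at a time. *)
Lemma Q_leafwise_block i a b : i < n -> valid n a -> valid n b ->
  agree_off n i a b -> a.1 i = b.1 i ->
  (forall j, j <= i -> b.2 i j <= a.2 i j) ->
  (forall j, j <= i -> a.2 i j = b.2 i j \/ irrelevant_leaf i j) ->
  Q a b.
Proof.
move=> li va vb ab ei ba H.
pose c t : coords :=
  (a.1, fun k j => if (k == i) && (j < t) then b.2 k j else a.2 k j).
have vc t : valid n (c t).
  split=> /= [k p kp lp|k j p lk jp lp|k j lk lj].
  - by rewrite (valid_stem va)//; lia.
  - have lj : j <= k by lia.
    case: eqP => [ek|_] /=; last by rewrite (valid_leaf va).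
    subst k; have := valid_leaf va li lj lp; have := valid_leaf vb li lj lp.
    have := ba j lj.
    by case: (ltnP j t); case: (ltnP p t); lia.
  - case: eqP => [ek|_] /=; last by case: va => _ _; apply.
    subst k.
    by case: (ltnP j t) => _; [rewrite ei; case: vb|case: va] => _ _; apply.
have Qc t : t <= i.+1 -> Q a (c t).
  elim: t => [_|t IH lt].
    by apply: Q_ext => // k lk; split=> //= j lj; rewrite andbF.
  apply: (Q_trans va (vc t)) => //; first exact/IH/ltnW.
  case: (H t lt) => [e|ir].
    apply: Q_ext => // k lk; split=> //= j lj.
    have [->|ne] := eqVneq j t; last by have -> : (j < t.+1) = (j < t) by lia.
    by rewrite ltnn leqnn andbF andbT; case: eqP => [->|].
  apply: Q_irrelevant_leaf ir _ _ _ => //; split=> //= k p lk lp nkp.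
  case: eqP nkp => //= -> np; have -> // : (p < t.+1) = (p < t).
  by have : p <> t by [move=> e; exact: np]; lia.
apply: (Q_trans va (vc i.+1)) => //; first exact: Qc.
apply: Q_ext => // k lk; split=> [/=|j lj /=].
  by have [->|/eqP nk] := eqVneq k i; [|case: (ab k lk nk)].
have [ek|/eqP nk] /= := eqVneq k i; first by rewrite -ek ltnS lj.
by case: (ab k lk nk) => _; apply.
Qed.

Lemma Q_leafwise a b : valid n a -> valid n b ->
  (forall i, i < n -> a.1 i = b.1 i) ->
  (forall i j, i < n -> j <= i -> b.2 i j <= a.2 i j) ->
  (forall i j, i < n -> j <= i -> a.2 i j = b.2 i j \/ irrelevant_leaf i j) ->
  Q a b.
Proof.
move=> va vb e ba H.
apply: Q_blockwise => // [k lk|t a' b' lt va' vb' off [ea la] [eb lb]].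
  by rewrite e.
apply: (@Q_leafwise_block t) => // [|j lj|j lj]; first by rewrite ea eb e.
  by rewrite la // lb // ba.
by rewrite la // lb //; exact: H.
Qed.

(** On spaced coordinates this moves the irrelevant stems to residue [d] modulo 3 and keeps the
    relevant ones at residue 0, so that the two kinds cannot collide. *)
Definition bump d (a : coords) : coords :=
  (fun i => if `[< irrelevant_stem i >] then a.1 i + d else a.1 i, a.2).

Lemma valid_bump d a : d < 3 -> valid n a -> spaced n a -> valid n (bump d a).
Proof.
move=> ld va sa; split=> /= [i k ik lk|i j p li jp lp|i j li lj].
- have [si _] := sa i (ltn_trans ik lk); have [sk _] := sa k lk.
  have := valid_stem va (ltn_trans ik lk) lk; rewrite ik.
  by do 2 case: ifP => _; lia.
- by case: va => _ h _; exact: h.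
- by case: va => _ _ h; have := h i j li lj; case: ifP => _; lia.
Qed.

Lemma Q_bump d a : 0 < d < 3 -> valid n a -> spaced n a -> Q a (bump d a).
Proof.
move=> /andP[d0 d3] va sa; have vb := valid_bump d3 va sa.
(* [Q_blockwise] only lowers stems, so the path runs from [bump d a] down to [a]. *)
apply: Q_sym => //; apply: Q_blockwise => //= [k lk|t a' b' lt va' vb' off aa bb].
  by case: ifP; lia.
case: (pselect (irrelevant_stem t)) => ir.
  apply: (Q_irrelevant_stem lt ir) => //.
  by case: aa => -> _; case: bb => -> _ /=; rewrite asboolT//; lia.
apply: Q_ext => // k lk; have [->|/eqP] := eqVneq k t; last exact: off.
case: aa bb => [ea la] [eb lb]; split=> [|j lj]; last by rewrite la // lb.
by rewrite ea eb /= asboolF.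
Qed.

(* Bumping the irrelevant stems of [a] first makes them all differ from those of
   [c], as needed to apply [Q_irrelevant_stem]. *)
Lemma Q_lower a c : valid n a -> spaced n a -> valid n c ->
  (forall i, i < n -> c.1 i <= a.1 i) ->
  (forall i, i < n -> ~ irrelevant_stem i -> agree_block i a c) -> Q a c.
Proof.
move=> va sa vc ca H; have v1 := @valid_bump 1 _ isT va sa.
apply: (Q_trans va v1 vc); first exact: Q_bump.
apply: Q_blockwise => //= [k lk|t a' b' lt va' vb' off [ea la] [eb lb]].
  by have := ca k lk; case: ifP; lia.
case: (pselect (irrelevant_stem t)) => ir.
  apply: (Q_irrelevant_stem lt ir) => //.
  by rewrite ea eb /= asboolT//; have := ca t lt; lia.
have [e h] := H t lt ir.
apply: Q_ext => // k lk; have [->|/eqP] := eqVneq k t; last exact: off.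
split=> [|j lj]; last by rewrite la // lb // -h.
by rewrite ea eb /= asboolF.
Qed.

Definition same_relevant (a b : coords) := forall i, i < n ->
  ~ irrelevant_stem i -> a.1 i = b.1 i /\
    forall j, j <= i -> ~ irrelevant_leaf i j -> a.2 i j = b.2 i j.

(** Over irrelevant stems the leaves are reset to the lowest ranks, which fit under any stem. If [a]
    and [b] agree on relevant coordinates, [meet_stems a b] and [meet_stems b a] thus differ only in
    irrelevant leaves. *)
Definition meet_stems (a b : coords) : coords :=
  (fun i => minn (a.1 i) (b.1 i),
   fun i j => if `[< irrelevant_stem i >] then j else a.2 i j).

Lemma valid_meet_stems a b : valid n a -> valid n b -> same_relevant a b ->
  valid n (meet_stems a b).
Proof.
move=> va vb ab; split=> /= [i k ik lk|i j p li jp lp|i j li lj].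
- have li := ltn_trans ik lk.
  by have := valid_stem va li lk; have := valid_stem vb li lk; lia.
- by case: ifP => // _; case: va => _ h _; exact: h.
- case: asboolP => [_|ir].
    by have := valid_stem_ge va li; have := valid_stem_ge vb li; lia.
  by have [<- _] := ab i li ir; rewrite minnn; case: va => _ _; apply.
Qed.

Lemma Q_meet_stems a b : valid n a -> valid n b -> spaced n a ->
  same_relevant a b -> Q a (meet_stems a b).
Proof.
move=> va vb sa ab; apply: Q_lower => // [|i li|i li ir].
- exact: valid_meet_stems.
- exact: geq_minl.
- have [e _] := ab i li ir; split=> [|j lj] /=; first by rewrite -e minnn.
  by rewrite asboolF.
Qed.

(** The path is [a], [c], [m], [d], [b]: stems are lowered to common values first, then irrelevant
    leaves to their minimum. *)
Lemma Q_of_same_relevant a b : valid n a -> valid n b -> spaced n a ->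
  spaced n b -> same_relevant a b -> Q a b.
Proof.
move=> va vb sa sb ab.
have ba : same_relevant b a.
  by move=> i li ir; have [-> h] := ab i li ir; split=> // j lj /(h j lj).
pose c := meet_stems a b; pose d := meet_stems b a.
have vc : valid n c by exact: valid_meet_stems.
have vd : valid n d by exact: valid_meet_stems.
pose m : coords := (c.1, fun i j => minn (c.2 i j) (d.2 i j)).
have ecd i : c.1 i = d.1 i by exact: minnC.
have vm : valid n m.
  split=> [i k ik lk|i j p li jp lp|i j li lj].
  - by case: vc => h _ _; exact: h.
  - have lj : j <= i by lia.
    have := valid_leaf vc li lj lp; have := valid_leaf vd li lj lp.
    by rewrite /=; lia.
  - by case: vc => _ _ h; have := h i j li lj; rewrite /m; cbn [fst snd]; lia.
have rel i j : i < n -> j <= i -> c.2 i j = d.2 i j \/ irrelevant_leaf i j.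
  move=> li lj; rewrite /c /d /=; case: asboolP => ir; first by left.
  case: (pselect (irrelevant_leaf i j)) => [|il]; [by right|left].
  by have [_] := ab i li ir; exact.
have mE i j : m.2 i j = minn (c.2 i j) (d.2 i j) by [].
have Qcm : Q c m.
  apply: Q_leafwise => // i j li lj; first exact: geq_minl.
  by case: (rel i j li lj) => [e|]; [left; rewrite mE -e minnn|right].
have Qdm : Q d m.
  apply: Q_leafwise => // [i li|i j li lj|i j li lj]; [|exact: geq_minr|].
    by rewrite -ecd.
  by case: (rel i j li lj) => [e|]; [left; rewrite mE e minnn|right].
apply: (Q_trans va vc vb); first exact: Q_meet_stems.
apply: (Q_trans vc vm vb) => //; apply: Q_sym => //.
by apply: (Q_trans vb vd vm) => //; exact: Q_meet_stems.
Qed.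

(* If [a.1 i] is no relevant stem of [b], then after bumping the irrelevant
   stems of [b] out of the way [a.1 i] can be moved without changing the type
   of the pair, which makes [i] irrelevant. *)
Lemma relevant_stem_sub a b i : valid n a -> valid n b -> spaced n a ->
  spaced n b -> Q a b -> i < n -> ~ irrelevant_stem i ->
  exists k, [/\ k < n, ~ irrelevant_stem k & a.1 i = b.1 k].
Proof.
move=> va vb sa sb Qab li ir; apply: contrapT => no; apply: ir.
have vb2 := @valid_bump 2 _ isT vb sb.
have Qab2 : Q a (bump 2 b) by apply: (Q_trans va vb vb2) => //; exact: Q_bump.
(* Stems of [bump 2 b] have residue 0 or 2 modulo 3, and none equals [a.1 i]; hence the step from
   residue 0 to residue 1 meets none of them. *)
pose a' : coords := (fun k => if k == i then a.1 k + 1 else a.1 k, a.2).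
have va' : valid n a'.
  split=> /= [k p kp lp|k j p lk jp lp|k j lk lj].
  - have lk := ltn_trans kp lp; have := valid_stem va lk lp; rewrite kp.
    by have [sk _] := sa k lk; have [sp _] := sa p lp; do 2 case: ifP => _; lia.
  - by case: va => _ h _; exact: h.
  - by case: va => _ _ h; have := h k j lk lj; case: ifP => _; lia.
exists a, a'; split=> //.
- by move=> k lk nk; split=> //=; case: eqP.
- by rewrite /= eqxx; lia.
apply: (Q_trans va vb2 va') => //; apply: Q_sym => //.
apply: (Q_type va vb2 va' vb2 _ Qab2) => k p lk lp /=.
case: (eqVneq k i) => [->|_]; last by split.
have [sp _] := sb p lp; have [si _] := sa i li.
case: asboolP => ip; first by split; [split|]; lia.
have ne : a.1 i <> b.1 p by move=> e; apply: no; exists p.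
by split; [split|]; lia.
Qed.

(** The residue argument for stems, repeated over the common stem of block [i]: irrelevant leaves of
    [b] go to residue 2, and the leaf of [a] moves to residue 1 without meeting a leaf of [b]. *)
Lemma relevant_leaf_sub a b i j : valid n a -> valid n b -> spaced n a ->
  spaced n b -> Q a b -> i < n -> a.1 i = b.1 i -> j <= i ->
  ~ irrelevant_leaf i j ->
  exists p, [/\ p <= i, ~ irrelevant_leaf i p & a.2 i j = b.2 i p].
Proof.
move=> va vb sa sb Qab li ei lj ir; apply: contrapT => no; apply: ir.
pose b' : coords := (b.1, fun k p =>
  if (k == i) && `[< irrelevant_leaf k p >] then b.2 k p + 2 else b.2 k p).
(* For multiples of three, a leaf below [c.1 k + 3] is at most [c.1 k], so raising it by two stays
   valid. *)
have bound (c : coords) k p : valid n c -> spaced n c -> k < n -> p <= k ->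
    c.2 k p + 2 < c.1 k + 3.
  move=> [_ _ h] sc lk lp; have := h k p lk lp; have [s1 s2] := sc k lk.
  by have := s2 p lp; lia.
have vb' : valid n b'.
  split=> /= [k p kp lp|k q p lk qp lp|k p lk lp].
  - by case: vb => h _ _; exact: h.
  - have lq : q <= k by lia.
    have := valid_leaf vb lk lq lp; rewrite qp; have [_ s] := sb k lk.
    by have := s q lq; have := s p lp; do 2 case: ifP => _; lia.
  - by have := bound b k p vb sb lk lp; case: ifP => _; lia.
have Qab' : Q a b'.
  apply: (Q_trans va vb vb') => //; apply: Q_sym => //.
  apply: Q_leafwise => //= k p lk lp; first by case: ifP => _; lia.
  case: eqP => [->|_] /=; last by left.
  by case: asboolP => h; [right|left].
pose a' : coords := (a.1, fun k p =>
  if (k == i) && (p == j) then a.2 k p + 1 else a.2 k p).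
have va' : valid n a'.
  split=> /= [k p kp lp|k q p lk qp lp|k p lk lp].
  - by case: va => h _ _; exact: h.
  - have lq : q <= k by lia.
    have := valid_leaf va lk lq lp; rewrite qp; have [_ s] := sa k lk.
    by have := s q lq; have := s p lp; do 2 case: ifP => _; lia.
  - by have := bound a k p va sa lk lp; case: ifP => _; lia.
exists a, a'; split=> //.
- by split=> //= k p lk lp nkp; case: ifP => // /andP[/eqP ? /eqP ?]; case: nkp.
- by rewrite /= !eqxx /=; lia.
apply: (Q_trans va vb' va') => //; apply: Q_sym => //.
apply: (Q_type va vb' va' vb' _ Qab') => k p lk lp /=.
split=> // e q r lq lr.
case: (eqVneq k i) => [ek|nk] //=; case: (eqVneq q j) => [eq|nq] //=; subst k q.
have ep : p = i.
  by have := valid_stem vb lp li; have := valid_stem vb li lp; lia.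
subst p; rewrite eqxx /=.
have [_ s] := sb i li; have := s r lr; have [_ s'] := sa i li; have := s' j lj.
case: asboolP => ip ? ?; first by split; lia.
have ne : a.2 i j <> b.2 i r by move=> ee; apply: no; exists r.
by split; lia.
Qed.

Theorem Q_canonical a b : valid n a -> valid n b -> spaced n a -> spaced n b ->
  (Q a b <-> same_relevant a b).
Proof.
move=> va vb sa sb; split; last exact: Q_of_same_relevant.
move=> Qab; have Qba := Q_sym va vb Qab.
have stems i : i < n -> ~ irrelevant_stem i -> a.1 i = b.1 i.
  apply: (@increasing_same_image n (fun i => ~ irrelevant_stem i))
    => [||k lk ir|k lk ir].
  - by case: va.
  - by case: vb.
  - exact: (relevant_stem_sub va vb).
  - exact: (relevant_stem_sub vb va).
move=> i li ir; have ei := stems i li ir; split=> // j; rewrite -ltnS.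
apply: (@increasing_same_image i.+1 (fun j => ~ irrelevant_leaf i j) (a.2 i))
  => [j' p jp lp|j' p jp lp|j' lj' il|j' lj' il].
- by case: va => _ h _; exact: h.
- by case: vb => _ h _; exact: h.
- exact: (relevant_leaf_sub va vb).
- exact: (relevant_leaf_sub vb va).
Qed.

End Canonization.

(** * Invariance under order type *)

Lemma subseq_iota l N :
  sorted ltn l -> (forall u, u \in l -> u < N) -> subseq l (iota 0 N).
Proof.
move=> sl lN; suff -> : l = [seq u <- iota 0 N | u \in l] by exact: filter_subseq.
apply: (irr_sorted_eq ltn_trans ltnn) => //.
  by apply: sorted_filter; [exact: ltn_trans|exact: iota_ltn_sorted].
move=> u; rewrite mem_filter mem_iota /= add0n.
by case: (boolP (u \in l)) => // /lN ->.
Qed.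

Lemma subseq_map_nth (s l : seq nat) :
  sorted ltn l -> (forall u, u \in l -> u < size s) ->
  subseq [seq nth 0 s u | u <- l] s.
Proof.
move=> sl ls; rewrite -[X in subseq _ X](mkseq_nth 0) /mkseq.
exact/map_subseq/subseq_iota.
Qed.

Lemma sorted_undup_sort (s : seq nat) : sorted ltn (sort leq (undup s)).
Proof.
rewrite ltn_sorted_uniq_leq sort_uniq undup_uniq sort_sorted//; exact: leq_total.
Qed.

Lemma sorted_ltn_map (f : nat -> nat) (s : seq nat) :
  {in s &, {homo f : i j / i < j}} -> sorted ltn s -> sorted ltn (map f s).
Proof.
move=> hf ss; rewrite sorted_map; apply: (sub_in_sorted (P := mem s)) ss => //.
Qed.

Definition transport (f : nat -> nat) (g : nat -> nat -> nat)
    (c : seq (nat * seq nat)) : seq (nat * seq nat) :=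
  [seq (f t.1, [seq g t.1 u | u <- t.2]) | t <- c].

(* A pattern [p] selects blocks of [c], and leaves of these, by position. *)
Definition subconf (p c : seq (nat * seq nat)) : seq (nat * seq nat) :=
  [seq (nth 0 (unzip1 c) t.1,
        [seq nth 0 (nth [::] (unzip2 c) t.1) u | u <- t.2]) | t <- p].

Definition position (S : seq nat) (V : nat -> seq nat)
    (c : seq (nat * seq nat)) : seq (nat * seq nat) :=
  transport (index^~ S) (fun k => index^~ (V k)) c.

(** This turns a relation between two configurations into a property of one joint configuration with
    two fixed patterns, the form that [config_ramsey] handles. *)
Lemma subconf_position f g S V (c : seq (nat * seq nat)) :
  (forall t, t \in c -> t.1 \in S /\ {subset t.2 <= V t.1}) ->
  subconf (position S V c) (transport f g [seq (k, V k) | k <- S]) =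
  transport f g c.
Proof.
move=> H; rewrite /subconf /position /transport /unzip1 /unzip2 -!map_comp.
apply/eq_in_map => -[k l] /H /= [kS lV].
rewrite (nth_map 0) ?index_mem// nth_index//; congr pair.
rewrite -map_comp; apply/eq_in_map => u /lV uV /=.
by rewrite (nth_map 0) ?index_mem// nth_index// (nth_map 0) ?index_mem// nth_index.
Qed.

Definition patterns B : seq (seq (nat * seq nat)) :=
  words_le [seq (t, s) | t <- iota 0 B, s <- words_le (iota 0 B) B] B.

Lemma position_patterns S V (c : seq (nat * seq nat)) B :
  (forall t, t \in c -> t.1 \in S /\ {subset t.2 <= V t.1}) ->
  size S <= B -> (forall k, size (V k) <= B) -> size c <= B ->
  (forall t, t \in c -> size t.2 <= B) -> position S V c \in patterns B.
Proof.
move=> H SB VB cB tB; apply: mem_words_le; last by rewrite size_map.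
move=> _ /mapP[t tc ->]; have [tS tV] := H t tc.
apply/allpairsP; exists (index t.1 S, [seq index u (V t.1) | u <- t.2]).
split=> //=; first by rewrite mem_iota add0n (leq_trans _ SB)// index_mem.
apply: mem_words_le; last by rewrite size_map; exact: tB.
move=> _ /mapP[u ut ->].
by rewrite mem_iota add0n (leq_trans _ (VB t.1))// index_mem; exact: tV.
Qed.

(** The list is finite, so a single refinement can be homogeneous for all its entries. *)
Definition pair_patterns B :
    seq (seq nat * (seq (nat * seq nat) * seq (nat * seq nat))) :=
  [seq (sh, pq) | sh <- words_le (iota 0 B.+1) B,
                  pq <- [seq (p, q) | p <- patterns B, q <- patterns B]].

Definition conf n (a : coords) : seq (nat * seq nat) :=
  [seq (a.1 i, [seq a.2 i j | j <- iota 0 i.+1]) | i <- iota 0 n].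

Lemma mem_conf n a t : t \in conf n a ->
  exists2 i, i < n & t = (a.1 i, [seq a.2 i j | j <- iota 0 i.+1]).
Proof. by move=> /mapP[i]; rewrite mem_iota add0n => li ->; exists i. Qed.

Definition realize n (E : nat -> seq nat) (e : nat -> nat) (a : coords) :=
  transport e (fun k => nth 0 (E (e k))) (conf n a).

Section TypeInvariance.
Variables (n : nat) (E : nat -> seq nat) (e : nat -> nat).
Hypothesis e_incr : {homo e : i j / i < j}.
Hypothesis e_large : forall i, i + 3 <= size (E (e i)).

Lemma config_transport S V f g :
  sorted ltn S -> (forall k, k \in S -> sorted ltn (V k)) ->
  (forall k, k \in S -> V k != [::]) ->
  {in S &, {homo f : i j / i < j}} ->
  (forall k, k \in S -> {in V k &, {homo g k : i j / i < j}}) ->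
  (forall k u, k \in S -> u \in V k -> g k u < f k + 3) ->
  config E (transport (e \o f) (fun k u => nth 0 (E (e (f k))) (g k u))
              [seq (k, V k) | k <- S]).
Proof.
move=> sS sV V0 mf mg bg; split.
  have -> : unzip1 (transport (e \o f) (fun k u => nth 0 (E (e (f k))) (g k u))
              [seq (k, V k) | k <- S]) = [seq e (f k) | k <- S].
    by rewrite /unzip1 /transport -!map_comp.
  by apply: sorted_ltn_map => // x y xS yS xy; exact/e_incr/mf.
move=> _ /mapP[_ /mapP[k kS ->] ->] /=; split.
  by have := V0 k kS; case: (V k).
rewrite (map_comp (nth 0 (E (e (f k)))) (g k)); apply: subseq_map_nth.
  by apply: sorted_ltn_map; [exact: mg|exact: sV].
move=> _ /mapP[u uV ->]; exact: leq_trans (bg k u kS uV) (e_large _).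
Qed.

Variables (z z' : bool -> coords).
Hypothesis vz : forall c, valid n (z c).
Hypothesis vz' : forall c, valid n (z' c).
Hypothesis zz' : same_type n (z true) (z false) (z' true) (z' false).

(** Validity alone fixes the order inside one member, and the reversed pair follows by symmetry. *)
Lemma same_type_all c d : same_type n (z c) (z d) (z' c) (z' d).
Proof.
have self b : same_type n (z b) (z b) (z' b) (z' b).
  move=> i k li lk.
  rewrite /same_order !(valid_stem (vz b))// !(valid_stem (vz' b))//.
  split=> // h; have eik : i = k.
    by have := valid_stem (vz b) li lk; have := valid_stem (vz b) lk li; lia.
  by subst k => j p lj lp; rewrite !(valid_leaf (vz b))// !(valid_leaf (vz' b)).
case: c; case: d => // i k li lk; have [[h1 h2] h3] := zz' lk li.
split=> [|h j p lj lp]; first by split.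
by have [? ?] := h3 (esym h) p j lp lj; split.
Qed.

Definition all_stems := sort leq (undup
  [seq (z q.1).1 q.2 | q <- [seq (c, i) | c <- [:: true; false], i <- iota 0 n]]).

Definition all_leaves k := sort leq (undup
  [seq (z q.1.1).2 q.1.2 q.2 | q <- [seq (p, j) |
      p <- [seq (c, i) | c <- [:: true; false], i <- iota 0 n], j <- iota 0 n]
    & ((z q.1.1).1 q.1.2 == k) && (q.2 <= q.1.2)]).

Lemma mem_all_stems k :
  reflect (exists c i, i < n /\ k = (z c).1 i) (k \in all_stems).
Proof.
rewrite mem_sort mem_undup; apply: (iffP mapP).
  move=> [_ /allpairsP[[c i] [_ /= +->]] ->]; rewrite mem_iota => li.
  by exists c, i.
move=> [c [i [li ->]]]; exists (c, i) => //; apply/allpairsP; exists (c, i).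
by rewrite mem_iota; split=> //; case: c.
Qed.

Lemma mem_all_leaves k u :
  reflect (exists c i j, [/\ i < n, j <= i, k = (z c).1 i & u = (z c).2 i j])
          (u \in all_leaves k).
Proof.
rewrite mem_sort mem_undup; apply: (iffP mapP).
  move=> [q]; rewrite mem_filter => /andP[/andP[/eqP <- lj]].
  move=> /allpairsP[[p j] [/allpairsP[[c i] [_ /= li ->]] _ eq]] ->; subst q.
  by exists c, i, j; split=> //; move: li; rewrite mem_iota.
move=> [c [i [j [li lj -> ->]]]]; exists ((c, i), j) => //.
rewrite mem_filter; apply/andP; split; first by rewrite /= eqxx lj.
apply/allpairsP; exists ((c, i), j); split=> //; last by rewrite mem_iota /=; lia.
by apply/allpairsP; exists (c, i); rewrite mem_iota; split=> //; case: c.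
Qed.

Lemma size_all_stems : size all_stems <= 2 * n.
Proof.
rewrite size_sort (leq_trans (size_undup _))// size_map size_allpairs size_iota.
by [].
Qed.

Lemma size_all_leaves k : size (all_leaves k) <= 2 * n * n.
Proof.
rewrite size_sort (leq_trans (size_undup _))// size_map size_filter.
by rewrite (leq_trans (count_size _ _))// !size_allpairs size_iota.
Qed.

(** Equality of type preserves coincidences between stems and between leaves over a common stem, so
    the assignment from [z] to [z'] is well defined; 0 is the default elsewhere. *)
Lemma exists_matching_maps : exists f g, forall c i, i < n ->
  f ((z c).1 i) = (z' c).1 i /\
  forall j, j <= i -> g ((z c).1 i) ((z c).2 i j) = (z' c).2 i j.
Proof.
have eq_order x y x' y' : same_order x y x' y' -> x = y -> x' = y'.
  by rewrite /same_order; lia.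
have [f Hf] : {f : nat -> nat & forall k c i, i < n ->
    (z c).1 i = k -> f k = (z' c).1 i}.
  apply: (@choice _ _ (fun k x => forall c i, i < n ->
    (z c).1 i = k -> x = (z' c).1 i)) => k.
  case: (pselect (exists c i, i < n /\ (z c).1 i = k)) => [[c [i [li ek]]]|no].
    exists ((z' c).1 i) => d p lp ep; have [o _] := same_type_all c d li lp.
    by apply: (eq_order _ _ _ _ o); rewrite ek ep.
  by exists 0 => c i li ek; case: no; exists c, i.
have [g Hg] : {g : nat * nat -> nat & forall k c i j, i < n -> j <= i ->
    (z c).1 i = k.1 -> (z c).2 i j = k.2 -> g k = (z' c).2 i j}.
  apply: (@choice _ _ (fun k x => forall c i j, i < n -> j <= i ->
    (z c).1 i = k.1 -> (z c).2 i j = k.2 -> x = (z' c).2 i j)) => -[k u] /=.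
  case: (pselect (exists c i j,
      [/\ i < n, j <= i, (z c).1 i = k & (z c).2 i j = u])).
    move=> [c [i [j [li lj ek eu]]]].
    exists ((z' c).2 i j) => d p q lp lq ep eq.
    have [_ o] := same_type_all c d li lp.
    by apply: (eq_order _ _ _ _ (o _ j q lj lq)); rewrite ?ek ?ep ?eu ?eq.
  by move=> no; exists 0 => c i j li lj ek eu; case: no; exists c, i, j.
exists f, (fun k u => g (k, u)) => c i li; split=> [|j lj]; first exact: Hf.
exact: Hg.
Qed.

(** The joint configuration of [z] and its image under the matching maps have the same shape and lie
    in [E]. Homogeneity gives them the same truth value for the two patterns, which select the
    members of [z] in one and those of [z'] in the other. *)
Lemma realize_same_type (R0 : seq (nat * seq nat) -> seq (nat * seq nat) -> Prop) :
  (forall j, j \in pair_patterns (2 * n + 2 * n * n) ->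
     homog E j.1 (fun c => `[< R0 (subconf j.2.1 c) (subconf j.2.2 c) >])) ->
  R0 (realize n E e (z true)) (realize n E e (z false)) ->
  R0 (realize n E e (z' true)) (realize n E e (z' false)).
Proof.
(* [2 * n] bounds the number of joint stems and [2 * n * n] the number of joint leaves over one
   stem. *)
set B := 2 * n + 2 * n * n => hom.
have [f [g fg]] := exists_matching_maps.
pose c0 := [seq (k, all_leaves k) | k <- all_stems].
have sub c t : t \in conf n (z c) ->
    t.1 \in all_stems /\ {subset t.2 <= all_leaves t.1}.
  move=> /mem_conf[i li ->]; split; first by apply/mem_all_stems; exists c, i.
  move=> _ /mapP[j + ->]; rewrite mem_iota /= add0n ltnS => lj.
  by apply/mem_all_leaves; exists c, i, j.
have leaves0 k : k \in all_stems -> all_leaves k != [::].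
  move=> /mem_all_stems[c [i [li ek]]].
  have : (z c).2 i 0 \in all_leaves k by apply/mem_all_leaves; exists c, i, 0.
  by case: (all_leaves k).
have cfg0 : config E (transport e (fun k => nth 0 (E (e k))) c0).
  apply: (@config_transport _ _ id (fun=> id)) => //.
  - exact: sorted_undup_sort.
  - by move=> k _; exact: sorted_undup_sort.
  - by move=> k _ u v.
  - move=> k u _ /mem_all_leaves[c [i [j [li lj -> ->]]]].
    by have [_ _ h] := vz c; exact: h.
have cfg1 : config E (transport (e \o f)
    (fun k u => nth 0 (E (e (f k))) (g k u)) c0).
  apply: config_transport => //.
  - exact: sorted_undup_sort.
  - by move=> k _; exact: sorted_undup_sort.
  - move=> _ _ /mem_all_stems[c [i [li ->]]] /mem_all_stems[d [p [lp ->]]].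
    have [-> _] := fg c i li; have [-> _] := fg d p lp.
    by have [[[h _] _] _] := same_type_all c d li lp.
  - move=> k _ u v /mem_all_leaves[c [i [j [li lj ek ->]]]].
    move=> /mem_all_leaves[d [p [q [lp lq ek' ->]]]].
    have [_ o] := same_type_all c d li lp.
    have [[h _] _] := o (etrans (esym ek) ek') j q lj lq; move=> /h.
    have [_ g1] := fg c i li; have [_ g2] := fg d p lp.
    by rewrite -g1// -g2// -ek -ek'.
  - move=> k u _ /mem_all_leaves[c [i [j [li lj -> ->]]]].
    have [-> ->//] := fg c i li; by have [_ _ h] := vz' c; exact: h.
pose pos c := position all_stems all_leaves (conf n (z c)).
have posB c : pos c \in patterns B.
  apply: position_patterns => //; first exact: sub.
  - exact: leq_trans size_all_stems (leq_addr _ _).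
  - by move=> k; exact: leq_trans (size_all_leaves k) (leq_addl _ _).
  - by rewrite size_map size_iota /B; lia.
  - by move=> t /mem_conf[i li ->] /=; rewrite size_map size_iota /B; lia.
pose sh := shape (unzip2 c0).
have shE f' g' : shape (unzip2 (transport f' g' c0)) = sh.
  rewrite /sh /shape /unzip2 /transport -!map_comp.
  by apply: eq_map => k /=; rewrite size_map.
have jB : (sh, (pos true, pos false)) \in pair_patterns B.
  apply/allpairsP; exists (sh, (pos true, pos false)); split=> //; last first.
    by apply/allpairsP; exists (pos true, pos false); split=> //; exact: posB.
  apply: mem_words_le; last first.
    by rewrite !size_map; exact: leq_trans size_all_stems (leq_addr _ _).
  move=> _ /mapP[_ /mapP[_ /mapP[k _ ->] ->] ->].
  rewrite mem_iota /= ltnS; exact: leq_trans (size_all_leaves k) (leq_addl _ _).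
have [b hb] := hom _ jB.
have := hb _ cfg0 (shE _ _); rewrite -(hb _ cfg1 (shE _ _)).
rewrite !subconf_position; try exact: sub.
have move_real c : transport (e \o f) (fun k u => nth 0 (E (e (f k))) (g k u))
    (conf n (z c)) = realize n E e (z' c).
  rewrite /realize /transport /conf -!map_comp; apply/eq_in_map => i.
  rewrite mem_iota add0n => /andP[_ li]; have [hf hg] := fg c i li.
  rewrite /comp; cbn [fst snd]; rewrite hf; congr pair.
  rewrite -!map_comp; apply/eq_in_map => j; rewrite mem_iota /= add0n ltnS => lj.
  by rewrite hg.
by rewrite !move_real => h /asboolP h1; apply/asboolP; rewrite -h.
Qed.

End TypeInvariance.

(** * Transfer to trees *)

Local Arguments iota : simpl never.

Lemma fat_subsequence E : fat E -> exists e : nat -> nat,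
  {homo e : i j / i < j} /\ forall i, i + 3 <= size (E (e i)).
Proof.
move=> [_ fE].
have [f Hf] := @choice _ _ (fun m k => m <= k /\ m <= size (E k))
  (fun m => let: ex_intro2 k h1 h2 := fE m in ex_intro _ k (conj h1 h2)).
(* The argument of [f] exceeds the previous stem, which makes [e] increase, and is at least [i + 3],
   which provides the leaves. *)
pose e := fix e i := if i is i'.+1 then f (e i' + i + 4) else f 3.
exists e; split.
  apply: homo_ltn => [|i]; first exact: ltn_trans.
  by have [h _] := Hf (e i + i.+1 + 4); rewrite [e i.+1]/=; lia.
case=> [|i]; first by have [_ h] := Hf 3.
have [_ h] := Hf (e i + i.+1 + 4); apply: leq_trans h; lia.
Qed.

Lemma mem_fset_seq (s : seq nat) u : (u \in [fset x in s]%fset) = (u \in s).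
Proof. by rewrite !inE. Qed.

Lemma set_fset_seq (s : seq nat) : [set` [fset x in s]%fset] = [set` s].
Proof. by apply/seteqP; split=> u /=; rewrite mem_fset_seq. Qed.

Definition union_fans (c : seq (nat * seq nat)) : set (seq nat) :=
  [set s | exists2 t, t \in c & fan t.1 [set` t.2] s].

Section Trees.
Variables (E : nat -> seq nat) (e : nat -> nat) (A : set (seq nat)).
Hypothesis e_incr : {homo e : i j / i < j}.
Hypothesis e_large : forall i, i + 3 <= size (E (e i)).
Hypothesis E_sorted : forall k, sorted ltn (E k).
Hypothesis E_bounded : forall k u, u \in E k -> u <= k.
Hypothesis E_sub : forall k u, u \in E k -> [/\ A [::], A [:: k] & A [:: k; u]].

Definition leaf_list (a : coords) i :=
  [seq nth 0 (E (e (a.1 i))) u | u <- [seq a.2 i j | j <- iota 0 i.+1]].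

Definition tree (a : coords) : set (seq nat) :=
  \bigcup_i fan (e (a.1 i)) [set` leaf_list a i].

Lemma e_inj : injective e.
Proof. by move=> x y exy; case: (ltngtP x y) => // /e_incr; rewrite exy ltnn. Qed.

Lemma size_leaf_list a i : size (leaf_list a i) = i.+1.
Proof. by rewrite !size_map size_iota. Qed.

Lemma nth_leaf_list a i j : j <= i ->
  nth 0 (leaf_list a i) j = nth 0 (E (e (a.1 i))) (a.2 i j).
Proof.
move=> lj; rewrite (nth_map 0) ?size_map ?size_iota//.
by rewrite (nth_map 0) ?size_iota// nth_iota.
Qed.

Lemma nth_E_ltn k u v : u < k + 3 -> v < k + 3 ->
  (nth 0 (E (e k)) u < nth 0 (E (e k)) v) = (u < v).
Proof.
move=> lu lv; have := e_large k => h.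
have := sorted_ltn_nth ltn_trans 0 (E_sorted (e k)) => mono.
have m1 := mono u v; have m2 := mono v u; rewrite !inE in m1 m2.
have {}m1 := m1 (leq_trans lu h) (leq_trans lv h).
have {}m2 := m2 (leq_trans lv h) (leq_trans lu h).
by case: (ltngtP u v) => [uv|uv|->]; [exact: m1|have := m2 uv; lia|rewrite ltnn].
Qed.

Lemma nth_E_inj k u v : u < k + 3 -> v < k + 3 ->
  nth 0 (E (e k)) u = nth 0 (E (e k)) v -> u = v.
Proof.
move=> lu lv h; have := nth_E_ltn lu lv; have := nth_E_ltn lv lu.
by rewrite h ltnn; lia.
Qed.

Lemma leaf_list_sub n a i : valid n a -> i < n ->
  {subset leaf_list a i <= E (e (a.1 i))}.
Proof.
move=> [_ _ h] li _ /mapP[_ /mapP[j + ->] ->]; rewrite mem_iota => lj.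
by apply: mem_nth; apply: leq_trans (e_large _); apply: h => //; lia.
Qed.

Lemma leaf_list_sorted n a i : valid n a -> i < n -> sorted ltn (leaf_list a i).
Proof.
move=> va li; rewrite /leaf_list -map_comp; apply: sorted_ltn_map; last first.
  exact: iota_ltn_sorted.
move=> j p; rewrite !mem_iota !add0n !ltnS /= => lj lp jp.
by have [_ _ h] := va; rewrite nth_E_ltn ?h// (valid_leaf va).
Qed.

Lemma presents_tree a : (forall n, valid n a) ->
  presents (tree a) (e \o a.1) (fun i => [fset x in leaf_list a i]%fset).
Proof.
move=> va; split.
- by move=> i j ij; apply: e_incr; have [h _ _] := va j.+1; exact: h.
- move=> i u; rewrite mem_fset_seq => ui; apply: E_bounded.
  exact: leaf_list_sub (va i.+1) (ltnSn i) _ ui.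
- move=> i; rewrite card_fseq undup_id ?size_leaf_list//.
  exact: sorted_uniq ltn_trans ltnn _ (leaf_list_sorted (va i.+1) (ltnSn i)).
- apply/seteqP; split=> s.
    move=> [i _ [[->|->]|[u ui <-]]]; first by left.
      by right; exists i => //; left.
    by right; exists i => //; right; exists u => //; rewrite set_fset_seq.
  move=> [->|[i _ [->|[u ui <-]]]].
  + by exists 0 => //; left; left.
  + by exists i => //; left; right.
  + by exists i => //; right; exists u => //; rewrite -set_fset_seq.
Qed.

Lemma tree_R1 a : (forall n, valid n a) -> R1 (tree a).
Proof.
move=> va; split; last first.
  exists (e \o a.1), (fun i => [fset x in leaf_list a i]%fset).
  exact: presents_tree.
move=> s [i _ [[->|->]|[u ui <-]]].
- by left; left.
- by left; right; exists (e (a.1 i)).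
- right; exists (e (a.1 i)), u; split=> //.
  by apply: E_bounded; exact: leaf_list_sub (va i.+1) (ltnSn i) _ ui.
Qed.

Lemma tree_sub a : (forall n, valid n a) -> tree a `<=` A.
Proof.
move=> va s [i _]; have lsub := leaf_list_sub (va i.+1) (ltnSn i).
(* Leaf lists are nonempty, and a single leaf puts the root and the stem into [A]. *)
have [A0 A1 _] : [/\ A [::], A [:: e (a.1 i)] & True].
  have : nth 0 (leaf_list a i) 0 \in leaf_list a i.
    by apply: mem_nth; rewrite size_leaf_list.
  by move=> /lsub/E_sub[].
by move=> [[->|->]|[u /lsub/E_sub[_ _ ?] <-]].
Qed.

Lemma union_fans_realize n a :
  union_fans (realize n E e a) =
  \bigcup_(i < n) fan (e (a.1 i)) [set` leaf_list a i].
Proof.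
apply/seteqP; split=> s.
  move=> [_ /mapP[_ /mapP[i + ->] ->]]; rewrite mem_iota add0n => li h.
  by exists i.
move=> [i li h]; exists (e (a.1 i), leaf_list a i) => //.
by apply/mapP; exists (a.1 i, [seq a.2 i j | j <- iota 0 i.+1]) => //;
  apply/mapP; exists i => //; rewrite mem_iota.
Qed.

Lemma approx_tree n a : (forall m, valid m a) ->
  approx n (tree a) = union_fans (realize n E e a).
Proof.
move=> va; rewrite union_fans_realize; apply: eq_bigcupr => i _.
by rewrite (blockE i (presents_tree va)) set_fset_seq.
Qed.

(** Membership in $\mathcal{AR}_n$ requires a full member of $\mathcal{R}_1$; further stems are
    added above the last one, [a.1 n.-1], with the lowest leaves. *)
Definition prolong n (a : coords) : coords :=
  (fun i => if i < n then a.1 i else a.1 n.-1 + i.+1,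
   fun i j => if i < n then a.2 i j else j).

Lemma valid_prolong n a : valid n a -> forall m, valid m (prolong n a).
Proof.
move=> va m; split=> /= [i k ik _|i j p _ jp lp|i j _ lj].
- case: (ltnP k n) => kn.
    by rewrite (ltn_trans ik kn); case: va => h _ _; exact: h.
  case: (ltnP i n) => ni; last by lia.
  suff : a.1 i <= a.1 n.-1 by lia.
  by rewrite leqNgt (valid_stem va) //; lia.
- by case: (ltnP i n) => // li; case: va => _ h _; exact: h.
- by case: (ltnP i n) => li; [case: va => _ _ h; exact: h|lia].
Qed.

Lemma realize_prolong n a : realize n E e (prolong n a) = realize n E e a.
Proof.
congr transport; apply/eq_in_map => i; rewrite mem_iota add0n => /andP[_ li] /=.
by rewrite li.
Qed.

Lemma AR_realize n a : valid n a -> AR_below n A (union_fans (realize n E e a)).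
Proof.
move=> va; have vp := valid_prolong va.
rewrite -realize_prolong -approx_tree//; split.
  by exists (tree (prolong n a)) => //; exact: tree_R1.
rewrite approx_tree// union_fans_realize => s [i _ h].
by apply: (tree_sub vp); exists i.
Qed.

Definition sparse : coords := (fun i => 3 * i, fun _ j => 3 * j).

Lemma valid_sparse n : valid n sparse.
Proof. by split=> /= *; lia. Qed.

(** The coordinates are read off by locating stems and leaves: the [i]-th stem of [x] is stem number
    [m i] of [tree sparse], hence has index [3 * m i], and [l i j] is the rank of a leaf in [E]. *)
Lemma AR_sparse n x : AR_below n (tree sparse) x -> exists a,
  [/\ valid n a, spaced n a, x = union_fans (realize n E e a) &
      forall i, i < n -> ablock x i = fan (e (a.1 i)) [set` leaf_list a i]].
Proof.
move=> [[X RX <-] sub]; have [_ [k [L pX]]] := RX.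
have [k_incr _ cardL _] := pX.
pose SL i := sort leq (L i : seq nat).
have SLs i : sorted ltn (SL i).
  rewrite ltn_sorted_uniq_leq sort_uniq fset_uniq sort_sorted//; exact: leq_total.
have memSL i u : (u \in SL i) = (u \in L i) by rewrite mem_sort.
have sizeSL i : size (SL i) = i.+1 by rewrite size_sort -(cardL i).
have inD i s : i < n -> fan (k i) [set` L i] s -> tree sparse s.
  by move=> li h; apply: sub; exists i => //; rewrite (blockE i pX).
have [m Hm] : exists m : nat -> nat, forall i, i < n ->
    k i = e (3 * m i) /\ forall u, u \in L i -> u \in leaf_list sparse (m i).
  suff [m Hm] : {m : nat -> nat & forall i, i < n ->
    k i = e (3 * m i) /\ forall u, u \in L i -> u \in leaf_list sparse (m i)}.
    by exists m.
  apply: (@choice _ _ (fun i m => i < n -> k i = e (3 * m) /\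
    forall u, u \in L i -> u \in leaf_list sparse m)) => i.
  case: (ltnP i n) => li; last by exists 0.
  have /(inD i _ li)[m _ /fan_stem ek] : fan (k i) [set` L i] [:: k i].
    exact/fan_stem.
  exists m => _; split=> // u uL.
  have /(inD i _ li)[m' _ /fan_leaf[]] : fan (k i) [set` L i] [:: k i; u].
    exact/fan_leaf.
  by rewrite ek => /e_inj /= h; have -> : m' = m by lia.
pose l i j := index (nth 0 (SL i) j) (E (e (3 * m i))).
have Hl i j : i < n -> j <= i -> [/\ l i j %% 3 = 0, l i j < 3 * m i + 3 &
    nth 0 (E (e (3 * m i))) (l i j) = nth 0 (SL i) j].
  move=> li lj; have [_ Lm] := Hm i li.
  have : nth 0 (SL i) j \in L i by rewrite -memSL mem_nth// sizeSL.
  move=> /Lm /mapP[_ /mapP[q + ->] /= eq]; rewrite mem_iota => lq.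
  have lt : 3 * q < 3 * m i + 3 by lia.
  have := leq_trans lt (e_large (3 * m i)) => lt'.
  have -> : l i j = 3 * q.
    rewrite /l eq index_uniq//; exact: sorted_uniq ltn_trans ltnn _ (E_sorted _).
  by split=> //; lia.
pose a : coords := (fun i => 3 * m i, l).
have leafE i : i < n -> leaf_list a i = SL i.
  move=> li; apply: (@eq_from_nth _ 0); rewrite size_leaf_list ?sizeSL// => j lj.
  by rewrite nth_leaf_list//; have [] := Hl i j li lj.
have ablE i : i < n -> fan (k i) [set` L i] = fan (e (a.1 i)) [set` leaf_list a i].
  move=> li; have [-> _] := Hm i li; congr fan; rewrite leafE//.
  by apply/seteqP; split=> u /=; rewrite memSL.
exists a; split.
- split=> [i p ip lp|i j p li jp lp|i j li lj].
  + have li := ltn_trans ip lp; have [ei _] := Hm i li; have [ep _] := Hm p lp.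
    have := k_incr _ _ ip; rewrite ei ep /=.
    case: (ltngtP (3 * m i) (3 * m p)) => //.
      by move=> /e_incr; lia.
    by move=> ->; rewrite ltnn.
  + have lj : j <= i by lia.
    have [_ l1 n1] := Hl i j li lj; have [_ l2 n2] := Hl i p li lp.
    rewrite -(nth_E_ltn l1 l2) n1 n2.
    by apply: (sorted_ltn_nth ltn_trans) => //; rewrite inE sizeSL ltnS.
  + by have [] := Hl i j li lj.
- by move=> i li; split=> [|j lj] /=; [lia|have [] := Hl i j li lj].
- rewrite union_fans_realize; apply: eq_bigcupr => i li.
  by rewrite (blockE i pX) ablE.
- by move=> i li; rewrite ablockE// (blockE i pX) ablE.
Qed.

(** Projections compare unlabelled sets of leaves. Both are increasing enumerations over the same
    index set, so equal sets force equality label by label. *)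
Lemma proj_fan_eq n a b i (P : nat -> Prop) : i < n -> valid n a -> valid n b ->
  proj (fan 0 [set j | j <= i /\ P j]) (fan (e (a.1 i)) [set` leaf_list a i]) =
  proj (fan 0 [set j | j <= i /\ P j]) (fan (e (b.1 i)) [set` leaf_list b i]) <->
  a.1 i = b.1 i /\ forall j, j <= i -> P j -> a.2 i j = b.2 i j.
Proof.
move=> li va vb; have sa := leaf_list_sorted va li.
have sb := leaf_list_sorted vb li.
rewrite !proj_fan//; split=> [/fan_inj[/e_inj ei im]|[ei h]]; last first.
  rewrite ei; congr fan; apply: eq_imagel => j [lj Pj].
  by rewrite !nth_leaf_list// ei h.
split=> // j lj Pj.
have incr (c : coords) p q : valid n c -> p < q -> q < i.+1 ->
    nth 0 (leaf_list c i) p < nth 0 (leaf_list c i) q.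
  move=> vc pq lq; apply: (sorted_ltn_nth ltn_trans);
    rewrite ?inE ?size_leaf_list//.
    exact: leaf_list_sorted vc li.
  exact: ltn_trans pq lq.
have : nth 0 (leaf_list a i) j = nth 0 (leaf_list b i) j.
  apply: (@increasing_same_image i.+1 P) => // [p q|p q|p lp Pp|p lp Pp].
  - exact: incr.
  - exact: incr.
  - have : [set nth 0 (leaf_list a i) j | j in [set j | j <= i /\ P j]]
        (nth 0 (leaf_list a i) p) by exists p.
    by rewrite im => -[q [lq Pq] <-]; exists q.
  - have : [set nth 0 (leaf_list b i) j | j in [set j | j <= i /\ P j]]
        (nth 0 (leaf_list b i) p) by exists p.
    by rewrite -im => -[q [lq Pq] <-]; exists q.
rewrite !nth_leaf_list// ei; apply: nth_E_inj.
  by rewrite -ei; have [_ _] := va; exact.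
by have [_ _] := vb; exact.
Qed.

End Trees.

(** * The canonical restriction *)

Theorem theorem4p3 (n : nat) (hn : (1 <= n)%N) (A : set (seq nat)) (hA : R1 A)
    (R : set (seq nat) -> set (seq nat) -> Prop)
    (hR : equiv_on (AR_below n A) R) :
  exists D : set (seq nat), [/\ R1 D, D `<=` A & canonical_on n D R].
Proof.
have [_ [k [L pA]]] := hA; have [k_incr L_le L_card AE] := pA.
have k_inj : injective k.
  by move=> x y exy; case: (ltngtP x y) => // /k_incr; rewrite exy ltnn.
(* [A] as a fat family: sorted leaf lists over its stems and empty lists elsewhere. *)
pose F := spread k (fun m => sort leq (L m : seq nat)).
have memF j u : u \in F j -> exists2 m, j = k m & u \in L m.
  case: (spreadN k (fun m => sort leq (L m : seq nat)) j) => [eF|[m ->]].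
    by rewrite /F eF.
  by rewrite /F spreadE// mem_sort; exists m.
have fF : fat F.
  split=> [j|m].
    rewrite /F.
    case: (spreadN k (fun m => sort leq (L m : seq nat)) j) => [->//|[m ->]].
    rewrite spreadE// ltn_sorted_uniq_leq sort_uniq fset_uniq sort_sorted//.
    exact: leq_total.
  exists (k m).
    by elim: m => // m IH; exact: leq_ltn_trans IH (k_incr _ _ (ltnSn m)).
  by rewrite /F spreadE// size_sort; have := L_card m; rewrite /= => ->.
pose R0 c d := R (union_fans c) (union_fans d).
(* Homogeneity for all pairs of patterns will make [R] depend only on the type of a pair. *)
have [|//|E [fE rE hE]] := @homog_all _ (pair_patterns (2 * n + 2 * n * n)) fst
  (fun j c => `[< R0 (subconf j.2.1 c) (subconf j.2.2 c) >]) F.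
  by move=> j P F0; exact: config_ramsey.
have [e [e_incr e_large]] := fat_subsequence fE.
have E_sorted := fE.1.
have E_bounded j u : u \in E j -> u <= j.
  by move=> /(mem_subseq (rE j))/memF[m -> ]; exact: L_le.
have E_sub j u : u \in E j -> [/\ A [::], A [:: j] & A [:: j; u]].
  move=> /(mem_subseq (rE j))/memF[m -> um]; rewrite AE; split; first by left.
    by right; exists m => //; left.
  by right; exists m => //; right; exists u.
pose Q a b := R0 (realize n E e a) (realize n E e b).
have AR_Q a : valid n a -> AR_below n A (union_fans (realize n E e a)).
  exact: AR_realize e_incr e_large E_sorted E_bounded E_sub n a.
have [R_refl R_sym R_trans] := hR.
have Q_refl a : valid n a -> Q a a by move=> /AR_Q; exact: R_refl.
have Q_sym a b : valid n a -> valid n b -> Q a b -> Q b a.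
  by move=> /AR_Q va /AR_Q vb; exact: R_sym.
have Q_trans a b c : valid n a -> valid n b -> valid n c -> Q a b -> Q b c -> Q a c.
  by move=> /AR_Q va /AR_Q vb /AR_Q vc; exact: R_trans.
have Q_type a b a' b' : valid n a -> valid n b -> valid n a' -> valid n b' ->
    same_type n a b a' b' -> Q a b -> Q a' b'.
  move=> va vb va' vb' ty.
  by apply: (@realize_same_type n E e e_incr e_large (fun c => if c then a else b)
    (fun c => if c then a' else b')) => // -[].
have vs := valid_sparse.
exists (tree E e sparse); split.
- exact: tree_R1 vs.
- exact: tree_sub vs.
(* An irrelevant stem gives $T_{\langle\rangle}$; otherwise the relevant leaves form $I$, and an
   empty $I$ gives $T_{\langle0\rangle}$. *)
exists (fun i => if `[< irrelevant_stem n Q i >] then [set [::]]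
  else fan 0 [set j | j <= i /\ ~ irrelevant_leaf n Q i j]); split.
  move=> i li; case: ifP => _; first by constructor 1.
  set I := [set j | _]; case: (pselect (I !=set0)) => I0.
    by constructor 3; exists I; split=> // j [].
  constructor 2; have -> : I = set0.
    by apply/seteqP; split=> // j Ij; case: I0; exists j.
  by rewrite /fan image_set0 setU0.
move=> x y Dx Dy.
have [a [va sa ex abA]] := AR_sparse e_incr e_large E_sorted Dx.
have [b [vb sb ey abB]] := AR_sparse e_incr e_large E_sorted Dy.
have QE : R x y <-> Q a b by rewrite ex ey.
apply: (iff_trans QE).
apply: (iff_trans (Q_canonical Q_refl Q_sym Q_trans Q_type va vb sa sb)).
split=> h i li; last first.
  move=> ir; have := h i li; rewrite asboolF// abA// abB//.
  by move=> /(proj_fan_eq e_incr e_large E_sorted _ li va vb).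
rewrite abA// abB//; case: asboolP => ir.
  rewrite !proj_root//; first exact: leaf_list_sorted vb li.
  exact: leaf_list_sorted va li.
by apply/(proj_fan_eq e_incr e_large E_sorted _ li va vb); exact: h.
Qed.
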